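(* Let $\mathsf{C}$ be a Markov category. The following hold for all objects and morphisms of the indicated types: (a) Symmetry: if $f:A\to X\otimes W\otimes Y$ displays $X\perp Y\,|\,W\,||\,A$, then the morphism $A\to Y\otimes W\otimes X$ obtained from $f$ by permuting the outputs displays $Y\perp X\,|\,W\,||\,A$. (b) Decomposition: if $f:A\to X_1\otimes X_2\otimes W\otimes Y$ displays $(X_1\otimes X_2)\perp Y\,|\,W\,||\,A$, then the marginal of $f$ on $X_1\otimes W\otimes Y$ displays $X_1\perp Y\,|\,W\,||\,A$. (c) Contraction: if $f:A\to X\otimes W\otimes Z\otimes Y$ displays $X\perp Y\,|\,(W\otimes Z)\,||\,A$ and the marginal of $f$ on $X\otimes W\otimes Z$ displays $X\perp Z\,|\,W\,||\,A$, then $f$ also displays $X\perp(Z\otimes Y)\,|\,W\,||\,A$. Moreover, if $\mathsf{C}$ has conditionals, then also: (d) Weak union: if $f:A\to X_1\otimes X_2\otimes W\otimes Y$ displays $(X_1\otimes X_2)\perp Y\,|\,W\,||\,A$, then it also displays $X_1\perp Y\,|\,(W\otimes X_2)\,||\,A$.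
   Context: A Markov category is a symmetric monoidal category $(\mathsf{C},\otimes,I)$ with symmetry $\mathsf{swap}_{X,Y}:X\otimes Y\to Y\otimes X$, in which every object $X$ is equipped with morphisms $\mathsf{copy}_X:X\to X\otimes X$ and $\mathsf{del}_X:X\to I$ forming a commutative comonoid (coassociative, counital, cocommutative), such that: (i) $\mathsf{del}_{X\otimes Y}$ is $\mathsf{del}_X\otimes\mathsf{del}_Y$ followed by $I\otimes I\cong I$; (ii) $\mathsf{copy}_{X\otimes Y}$ is $\mathsf{copy}_X\otimes\mathsf{copy}_Y$ followed by the canonical isomorphism $(X\otimes X)\otimes(Y\otimes Y)\cong(X\otimes Y)\otimes(X\otimes Y)$ swapping the two middle factors; (iii) $\mathsf{del}_Y\circ f=\mathsf{del}_X$ for every $f:X\to Y$. Associators and unitors are suppressed in formulas. Write $\mathsf{copy}^{(3)}_W:=(\mathsf{copy}_W\otimes\mathrm{id}_W)\circ\mathsf{copy}_W:W\to W\otimes W\otimes W$. The marginal of a morphism on some of its output factors is obtained by composing with $\mathsf{del}$ on all the other output factors. A morphism $f:A\to X\otimes W\otimes Y$ displays the conditional independence $X\perp Y\,|\,W\,||\,A$ if there are $g:A\to W$, $h:A\otimes W\to X$ and $k:W\otimes A\to Y$ such that $f=(h\otimes\mathrm{id}_W\otimes k)\circ(\mathrm{id}_A\otimes\mathsf{copy}^{(3)}_W\otimes\mathrm{id}_A)\circ(\mathrm{id}_A\otimes g\otimes\mathrm{id}_A)\circ\mathsf{copy}^{(3)}_A$. When the output factors of a morphism appear in a different order, the condition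 is applied after reordering the outputs by symmetry isomorphisms (e.g. in (d), to the order $X_1\otimes(W\otimes X_2)\otimes Y$). $\mathsf{C}$ has conditionals if for every $f:A\to X\otimes Y$ there is $f_{|X}:X\otimes A\to Y$ such that $f=(\mathrm{id}_X\otimes f_{|X})\circ(\mathsf{copy}_X\otimes\mathrm{id}_A)\circ(f_X\otimes\mathrm{id}_A)\circ\mathsf{copy}_A$, where $f_X:=(\mathrm{id}_X\otimes\mathsf{del}_Y)\circ f:A\to X$. *)

(* Defs.v *)
Set Implicit Arguments.
Unset Strict Implicit.
Unset Printing Implicit Defensive.

Declare Scope markov_scope.
Delimit Scope markov_scope with markov.
Local Open Scope markov_scope.

Reserved Notation "g ∘ f" (at level 40, left associativity).
Reserved Notation "X ⊗ Y" (at level 36, left associativity).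
Reserved Notation "f ⊗m g" (at level 36, left associativity).

Record category : Type := Category {
  ob :> Type;
  hom : ob -> ob -> Type;
  id : forall X, hom X X;
  comp : forall X Y Z, hom Y Z -> hom X Y -> hom X Z;
  comp_idl : forall X Y (f : hom X Y), comp (id Y) f = f;
  comp_idr : forall X Y (f : hom X Y), comp f (id X) = f;
  comp_assoc : forall X Y Z T (h : hom Z T) (g : hom Y Z) (f : hom X Y),
    comp h (comp g f) = comp (comp h g) f
}.

Arguments hom {_} X Y.
Arguments id {_} X.
Arguments comp {_ X Y Z} g f.
Notation "g ∘ f" := (comp g f) : markov_scope.

(* The tensor is not assumed strict.  [X ⊗ Y ⊗ Z] means [(X ⊗ Y) ⊗ Z], and
   [f ⊗m g] is the tensor of morphisms. *)
Record symMonCategory : Type := SymMonCategory {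
  smc_category :> category;
  unit_ob : smc_category;
  tensor : smc_category -> smc_category -> smc_category
    where "X ⊗ Y" := (tensor X Y);
  tensor_hom : forall X X' Y Y' : smc_category,
    hom X X' -> hom Y Y' -> hom (X ⊗ Y) (X' ⊗ Y')
    where "f ⊗m g" := (tensor_hom f g);
  tensor_id : forall X Y : smc_category, id X ⊗m id Y = id (X ⊗ Y);
  tensor_comp : forall (X X' X'' Y Y' Y'' : smc_category)
      (f' : hom X' X'') (f : hom X X') (g' : hom Y' Y'') (g : hom Y Y'),
    (f' ∘ f) ⊗m (g' ∘ g) = (f' ⊗m g') ∘ (f ⊗m g);
  assoc : forall X Y Z : smc_category, hom (X ⊗ Y ⊗ Z) (X ⊗ (Y ⊗ Z));
  assoc_inv : forall X Y Z : smc_category, hom (X ⊗ (Y ⊗ Z)) (X ⊗ Y ⊗ Z);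
  lunit : forall X : smc_category, hom (unit_ob ⊗ X) X;
  lunit_inv : forall X : smc_category, hom X (unit_ob ⊗ X);
  runit : forall X : smc_category, hom (X ⊗ unit_ob) X;
  runit_inv : forall X : smc_category, hom X (X ⊗ unit_ob);
  swap : forall X Y : smc_category, hom (X ⊗ Y) (Y ⊗ X);
  assocK : forall X Y Z, assoc_inv X Y Z ∘ assoc X Y Z = id (X ⊗ Y ⊗ Z);
  assoc_invK : forall X Y Z, assoc X Y Z ∘ assoc_inv X Y Z = id (X ⊗ (Y ⊗ Z));
  assoc_natural : forall (X X' Y Y' Z Z' : smc_category)
      (f : hom X X') (g : hom Y Y') (h : hom Z Z'),
    assoc X' Y' Z' ∘ ((f ⊗m g) ⊗m h) = (f ⊗m (g ⊗m h)) ∘ assoc X Y Z;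
  lunitK : forall X, lunit_inv X ∘ lunit X = id (unit_ob ⊗ X);
  lunit_invK : forall X, lunit X ∘ lunit_inv X = id X;
  lunit_natural : forall (X X' : smc_category) (f : hom X X'),
    lunit X' ∘ (id unit_ob ⊗m f) = f ∘ lunit X;
  runitK : forall X, runit_inv X ∘ runit X = id (X ⊗ unit_ob);
  runit_invK : forall X, runit X ∘ runit_inv X = id X;
  runit_natural : forall (X X' : smc_category) (f : hom X X'),
    runit X' ∘ (f ⊗m id unit_ob) = f ∘ runit X;
  triangle : forall X Y,
    (id X ⊗m lunit Y) ∘ assoc X unit_ob Y = runit X ⊗m id Y;
  pentagon : forall X Y Z T,
    (id X ⊗m assoc Y Z T) ∘ assoc X (Y ⊗ Z) T ∘ (assoc X Y Z ⊗m id T)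
    = assoc X Y (Z ⊗ T) ∘ assoc (X ⊗ Y) Z T;
  swap_natural : forall (X X' Y Y' : smc_category)
      (f : hom X X') (g : hom Y Y'),
    swap X' Y' ∘ (f ⊗m g) = (g ⊗m f) ∘ swap X Y;
  swapK : forall X Y, swap Y X ∘ swap X Y = id (X ⊗ Y);
  hexagon : forall X Y Z,
    assoc Y Z X ∘ swap X (Y ⊗ Z) ∘ assoc X Y Z
    = (id Y ⊗m swap X Z) ∘ assoc Y X Z ∘ (swap X Y ⊗m id Z)
}.

Arguments unit_ob {_}.
Arguments tensor {_} X Y.
Arguments tensor_hom {_ X X' Y Y'} f g.
Arguments assoc {_} X Y Z.
Arguments assoc_inv {_} X Y Z.
Arguments lunit {_} X.
Arguments lunit_inv {_} X.
Arguments runit {_} X.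
Arguments runit_inv {_} X.
Arguments swap {_} X Y.
Notation "X ⊗ Y" := (tensor X Y) : markov_scope.
Notation "f ⊗m g" := (tensor_hom f g) : markov_scope.

(* Exchange of the two middle factors. *)
Definition mid_swap (C : symMonCategory) (X Y Z T : C) :
    hom ((X ⊗ Y) ⊗ (Z ⊗ T)) ((X ⊗ Z) ⊗ (Y ⊗ T)) :=
  assoc_inv X Z (Y ⊗ T) ∘ (id X ⊗m assoc Z Y T)
  ∘ (id X ⊗m (swap Y Z ⊗m id T))
  ∘ (id X ⊗m assoc_inv Y Z T) ∘ assoc X Y (Z ⊗ T).

Record markovCategory : Type := MarkovCategory {
  mc_smc :> symMonCategory;
  copy : forall X : mc_smc, hom X (X ⊗ X);
  del : forall X : mc_smc, hom X unit_ob;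
  copy_coassoc : forall X,
    assoc X X X ∘ (copy X ⊗m id X) ∘ copy X = (id X ⊗m copy X) ∘ copy X;
  copy_counitl : forall X, lunit X ∘ (del X ⊗m id X) ∘ copy X = id X;
  copy_counitr : forall X, runit X ∘ (id X ⊗m del X) ∘ copy X = id X;
  copy_cocomm : forall X, swap X X ∘ copy X = copy X;
  del_tensor : forall X Y, del (X ⊗ Y) = lunit unit_ob ∘ (del X ⊗m del Y);
  copy_tensor : forall X Y,
    copy (X ⊗ Y) = mid_swap X X Y Y ∘ (copy X ⊗m copy Y);
  del_natural : forall (X Y : mc_smc) (f : hom X Y), del Y ∘ f = del X
}.

Arguments copy {_} X.
Arguments del {_} X.

Section MarkovDefs.

Variable C : markovCategory.

Definition copy3 (W : C) : hom W (W ⊗ W ⊗ W) := (copy W ⊗m id W) ∘ copy W.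

Definition discard_r (X Y : C) : hom (X ⊗ Y) X := runit X ∘ (id X ⊗m del Y).

(* Regrouping of A ⊗ copy3(W) ⊗ A as (A ⊗ W) ⊗ W ⊗ (W ⊗ A), the domain of
   h ⊗ id_W ⊗ k in the definition of conditional independence. *)
Definition ci_regroup (A W : C) :
    hom (A ⊗ (W ⊗ W ⊗ W) ⊗ A) ((A ⊗ W) ⊗ W ⊗ (W ⊗ A)) :=
  assoc (A ⊗ W ⊗ W) W A
  ∘ (((assoc_inv A W W ⊗m id W) ∘ assoc_inv A (W ⊗ W) W) ⊗m id A).

(* [displays_ci f] with f : A -> X ⊗ W ⊗ Y : f displays X ⊥ Y | W || A. *)
Definition displays_ci (A X W Y : C) (f : hom A (X ⊗ W ⊗ Y)) : Prop :=
  exists (g : hom A W) (h : hom (A ⊗ W) X) (k : hom (W ⊗ A) Y),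
    f = (h ⊗m id W ⊗m k) ∘ ci_regroup A W ∘ (id A ⊗m copy3 W ⊗m id A)
        ∘ (id A ⊗m g ⊗m id A) ∘ copy3 A.

Definition has_conditionals : Prop :=
  forall (A X Y : C) (f : hom A (X ⊗ Y)),
  exists c : hom (X ⊗ A) Y,
    f = (id X ⊗m c) ∘ assoc X X A ∘ (copy X ⊗m id A)
        ∘ ((discard_r X Y ∘ f) ⊗m id A) ∘ copy A.

End MarkovDefs.

Arguments copy3 {C} W.
Arguments discard_r {C} X Y.
Arguments ci_regroup {C} A W.
Arguments displays_ci {C} {A} X W Y f.

(* Symmetry isomorphism exchanging the outer factors. *)
Definition outer_swap (C : symMonCategory) (X W Y : C) :
    hom (X ⊗ W ⊗ Y) (Y ⊗ W ⊗ X) :=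
  assoc_inv Y W X ∘ (id Y ⊗m swap X W) ∘ swap (X ⊗ W) Y.

(* Main.v *)
(* Write ⟨f, g⟩ = (f ⊗ g) ∘ copy.  A morphism displays X ⊥ Y | W || A exactly when
   it is ⟨⟨h, π₁⟩, k⟩ ∘ ⟨g, id⟩: sample w from g, then sample x and y independently
   given w and the input.  Structural morphisms are tuples of projections and are
   deterministic, i.e. tuples can be precomposed with them componentwise; this
   replaces all coherence arguments.  Then (a) and (b) are immediate.  In (c), the
   output y depends on (w, z) and the input only, so f samples the marginal on
   X ⊗ W ⊗ Z and then y; by the second hypothesis that marginal samples w, then x
   and z independently, so x is independent of (z, y) given w.  In (d), a
   conditional of h given x2 lets one sample x2 together with w before x1. *)
Require Import Defs.
From Corelib Require Import ssreflect.
Set Implicit Arguments.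
Unset Strict Implicit.
Local Open Scope markov_scope.

Lemma comp_reassoc {C : category} {X Y Z : C} {g : hom Y Z} {f : hom X Y}
    {e : hom X Z} :
  g ∘ f = e -> forall T (k : hom T X), g ∘ (f ∘ k) = e ∘ k.
Proof. by move=> <- T k; rewrite comp_assoc. Qed.

Lemma comp_reassoc3 {C : category} {X Y Z W : C} {h : hom Z W} {g : hom Y Z}
    {f : hom X Y} {e : hom X W} :
  h ∘ g ∘ f = e -> forall T (k : hom T X), h ∘ (g ∘ (f ∘ k)) = e ∘ k.
Proof. by move=> <- T k; rewrite !comp_assoc. Qed.

(* Rewriting modulo associativity: composites are nested to the right, and [E] is tried first with a
   trailing factor, then without one. *)
Tactic Notation "rewA" uconstr(E) :=
  rewrite -?comp_assoc;
  first [ rewrite (comp_reassoc3 E) | rewrite (comp_reassoc E)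
        | rewrite (eq_trans (comp_assoc _ _ _) E) | rewrite E ];
  rewrite -?comp_assoc.

(** * Unitors against associators and the symmetry *)

Section Coherence.

Context {C : symMonCategory}.
Implicit Types X Y Z T : C.
Local Notation I := unit_ob.

Lemma tensor_compl X X' X'' Y Y' (f' : hom X' X'') (f : hom X X')
    (g : hom Y Y') :
  (f' ∘ f) ⊗m g = (f' ⊗m g) ∘ (f ⊗m id Y).
Proof. by rewrite -tensor_comp comp_idr. Qed.

Lemma tensor_compr X X' Y Y' Y'' (f : hom X X') (g' : hom Y' Y'')
    (g : hom Y Y') :
  f ⊗m (g' ∘ g) = (f ⊗m g') ∘ (id X ⊗m g).
Proof. by rewrite -tensor_comp comp_idr. Qed.

Lemma tensor_split X X' Y Y' (f : hom X X') (g : hom Y Y') :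
  f ⊗m g = (id X' ⊗m g) ∘ (f ⊗m id Y).
Proof. by rewrite -tensor_comp comp_idr comp_idl. Qed.

Lemma unit_tensor_inj X Y (f g : hom X Y) :
  id I ⊗m f = id I ⊗m g -> f = g.
Proof.
move=> E; rewrite -(comp_idr f) -(comp_idr g) -(lunit_invK X) !comp_assoc.
by rewrite -!lunit_natural E.
Qed.

Lemma tensor_unit_inj X Y (f g : hom X Y) :
  f ⊗m id I = g ⊗m id I -> f = g.
Proof.
move=> E; rewrite -(comp_idr f) -(comp_idr g) -(runit_invK X) !comp_assoc.
by rewrite -!runit_natural E.
Qed.

Lemma comp_injr X Y Z (f g : hom Y Z) (e : hom X Y) (e' : hom Y X) :
  e ∘ e' = id Y -> f ∘ e = g ∘ e -> f = g.
Proof.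
by move=> K E; rewrite -(comp_idr f) -(comp_idr g) -K !comp_assoc E.
Qed.

Lemma comp_injl X Y Z (f g : hom X Y) (e : hom Y Z) (e' : hom Z Y) :
  e' ∘ e = id Y -> e ∘ f = e ∘ g -> f = g.
Proof.
by move=> K E; rewrite -(comp_idl f) -(comp_idl g) -K -!comp_assoc E.
Qed.

(* Kelly: the unit laws below follow from the pentagon and the triangle, since
   tensoring with the unit object is faithful. *)
Lemma lunit_assoc X Y : lunit (X ⊗ Y) ∘ assoc I X Y = lunit X ⊗m id Y.
Proof.
apply: unit_tensor_inj.
(* Precomposing with two invertible associators exposes the pentagon at [I], [I], [X], [Y]. *)
apply: (@comp_injr _ _ _ _ _ (assoc I (I ⊗ X) Y) (assoc_inv _ _ _)).
  exact: assoc_invK.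
apply: (@comp_injr _ _ _ _ _ (assoc I I X ⊗m id Y) (assoc_inv _ _ _ ⊗m id Y)).
  by rewrite -tensor_comp assoc_invK comp_idl tensor_id.
rewrite tensor_compr.
rewA (pentagon _ _ _ _).
rewA (triangle _ _).
rewrite -tensor_id. rewA (eq_sym (assoc_natural _ _ _)).
rewA (eq_sym (assoc_natural _ _ _)).
by rewrite -tensor_comp triangle comp_idl.
Qed.

Lemma runit_assoc X Y : (id X ⊗m runit Y) ∘ assoc X Y I = runit (X ⊗ Y).
Proof.
apply: tensor_unit_inj.
apply: (@comp_injl _ _ _ _ _ (assoc X Y I) (assoc_inv _ _ _)).
  exact: assocK.
rewrite tensor_compl. rewA (assoc_natural _ _ _).
rewrite -(triangle Y) tensor_compr.
rewA (pentagon _ _ _ _).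
rewA (eq_sym (assoc_natural _ _ _)).
by rewrite tensor_id triangle.
Qed.

(** The hexagon at [X], [I], [I], followed by two left unitors, gives this equation tensored with
    [I] and postcomposed with the invertible [lunit X ∘ swap X I]; both are cancelled. *)
Lemma lunit_swap X : lunit X ∘ swap X I = runit X.
Proof.
apply: tensor_unit_inj.
have -> : runit X ⊗m id I = runit (X ⊗ I).
  apply: (@comp_injl _ _ _ _ _ (runit X) (runit_inv X)); first exact: runitK.
  exact: runit_natural.
apply: (@comp_injl _ _ _ _ _ (lunit X ∘ swap X I) (swap I X ∘ lunit_inv X)).
  by rewA (lunitK _); rewrite comp_idl swapK.
rewrite tensor_compl -lunit_assoc.
have := f_equal (fun u => lunit X ∘ (id I ⊗m lunit X) ∘ u) (hexagon X I I).
move=> /=.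
rewA (triangle _ _). rewA (eq_sym (swap_natural _ _)).
rewA (runit_assoc _ _) => H.
rewrite H.
rewA (lunit_natural _).
by rewA (lunit_natural (swap X I)).
Qed.

Lemma runit_swap X : runit X ∘ swap I X = lunit X.
Proof. by rewrite -lunit_swap -comp_assoc swapK comp_idr. Qed.

End Coherence.

(* Locked, since unification would otherwise see through them to the composites
   they stand for. *)
Definition proj1 {C : markovCategory} (X Y : C) : hom (X ⊗ Y) X :=
  locked (discard_r X Y).
Definition proj2 {C : markovCategory} (X Y : C) : hom (X ⊗ Y) Y :=
  locked (lunit Y ∘ (del X ⊗m id Y)).
Notation π₁ := (proj1 _ _).
Notation π₂ := (proj2 _ _).

(** * Projections against the structural morphisms *)

Section Projections.

Context {C : markovCategory}.
Implicit Types A X Y Z T : C.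

Lemma proj1_tensor X X' Y Y' (f : hom X X') (g : hom Y Y') :
  π₁ ∘ (f ⊗m g) = f ∘ π₁.
Proof.
rewrite /proj1 -!lock /discard_r comp_assoc -runit_natural -!comp_assoc -!tensor_comp.
by rewrite del_natural comp_idr !comp_idl.
Qed.

Lemma proj2_tensor X X' Y Y' (f : hom X X') (g : hom Y Y') :
  π₂ ∘ (f ⊗m g) = g ∘ π₂.
Proof.
rewrite /proj2 -!lock comp_assoc -lunit_natural -!comp_assoc -!tensor_comp.
by rewrite del_natural comp_idr !comp_idl.
Qed.

Lemma proj1_tensor_id X Y Z : (id X ⊗m proj2 Y Z) ∘ assoc X Y Z = π₁ ⊗m id Z.
Proof.
rewrite /proj1 /proj2 -!lock /discard_r tensor_compr.
rewA (eq_sym (assoc_natural _ _ _)).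
by rewA (triangle _ _); rewrite -tensor_comp comp_idl.
Qed.

Lemma proj2_assoc X Y Z : π₂ ∘ assoc X Y Z = π₂ ⊗m id Z.
Proof.
rewrite /proj2 -!lock -tensor_id; rewA (eq_sym (assoc_natural _ _ _)).
by rewA (lunit_assoc _ _); rewrite -tensor_comp comp_idl.
Qed.

Lemma proj1_assoc X Y Z : (id X ⊗m π₁) ∘ assoc X Y Z = π₁.
Proof.
rewrite /proj1 -!lock /discard_r tensor_compr. rewA (eq_sym (assoc_natural _ _ _)).
by rewA (runit_assoc _ _); rewrite tensor_id.
Qed.

Lemma proj2_swap X Y : π₂ ∘ swap X Y = π₁.
Proof. rewrite /proj1 /proj2 -!lock /discard_r.
by rewA (eq_sym (swap_natural _ _)); rewA (lunit_swap _). Qed.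

Lemma proj1_swap X Y : π₁ ∘ swap X Y = π₂.
Proof.
rewrite /proj1 /proj2 -!lock /discard_r.
by rewA (eq_sym (swap_natural _ _)); rewA (runit_swap _).
Qed.

Lemma proj1_assoc_inv X Y Z : π₁ ∘ assoc_inv X Y Z = id X ⊗m π₁.
Proof. by rewrite -proj1_assoc; rewA (assoc_invK _ _ _); rewrite comp_idr. Qed.

Lemma proj1_assoc_inv_tensor X Y Z :
  (π₁ ⊗m id Z) ∘ assoc_inv X Y Z = id X ⊗m π₂.
Proof. by rewrite -proj1_tensor_id; rewA (assoc_invK _ _ _); rewrite comp_idr. Qed.

Lemma proj2_assoc_inv_tensor X Y Z : (π₂ ⊗m id Z) ∘ assoc_inv X Y Z = π₂.
Proof. by rewrite -proj2_assoc -comp_assoc assoc_invK comp_idr. Qed.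

Lemma proj2_assoc_inv X Y Z : π₂ ∘ assoc_inv X Y Z = π₂ ∘ π₂.
Proof.
by rewrite -[in RHS]proj2_assoc_inv_tensor [RHS]comp_assoc proj2_tensor comp_idl.
Qed.

(** Leaving [u] arbitrary covers both [π₁] and [π₂] in the second slot. *)
Lemma mid_swap_proj1 X Y Z T V (u : hom (Y ⊗ T) V) :
  (π₁ ⊗m u) ∘ mid_swap X Y Z T
  = (id X ⊗m (u ∘ (id Y ⊗m π₂))) ∘ assoc X Y (Z ⊗ T).
Proof.
rewrite /mid_swap tensor_split -proj1_tensor_id.
rewA (assoc_invK _ _ _); rewrite comp_idl.
do 4!(rewrite (comp_assoc (id X ⊗m _)) -tensor_comp comp_idl).
rewA (proj2_assoc _ _ _).
by rewrite (comp_assoc (_ ⊗m _)) -tensor_comp proj2_swap comp_idl proj1_assoc_inv_tensor.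
Qed.

Lemma mid_swap_proj11 X Y Z T : (π₁ ⊗m π₁) ∘ mid_swap X Y Z T = π₁.
Proof. by rewrite mid_swap_proj1 proj1_tensor comp_idl proj1_assoc. Qed.

Lemma mid_swap_proj12 X Y Z T : (π₁ ⊗m π₂) ∘ mid_swap X Y Z T = π₁ ⊗m π₂.
Proof.
rewrite mid_swap_proj1 proj2_tensor tensor_compr -comp_assoc.
by rewrite proj1_tensor_id -tensor_split.
Qed.

Lemma mid_swap_proj22 X Y Z T : (π₂ ⊗m π₂) ∘ mid_swap X Y Z T = π₂.
Proof.
rewrite /mid_swap tensor_split.
rewA (proj2_assoc_inv_tensor _ _ _).
do 3!rewA (proj2_tensor _ _).
rewA (proj1_tensor_id _ _ _).
rewrite (comp_assoc (_ ⊗m _)) -tensor_comp comp_idl proj1_swap.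
rewA (proj2_assoc_inv_tensor _ _ _).
by rewrite proj2_assoc proj2_tensor comp_idl.
Qed.

End Projections.

(** * Tuples and deterministic morphisms *)

Definition pair {C : markovCategory} (A X Y : C) (f : hom A X) (g : hom A Y) :
    hom A (X ⊗ Y) :=
  locked ((f ⊗m g) ∘ copy A).
Notation "⟨ f , g ⟩" := (pair f g) (format "⟨ f ,  g ⟩") : markov_scope.

Definition deterministic {C : markovCategory} (X Y : C) (d : hom X Y) : Prop :=
  copy Y ∘ d = ⟨d, d⟩.

Create HintDb det.

Section Pairing.

Context {C : markovCategory}.
Implicit Types A B X Y Z T W : C.

Lemma proj1_pair A X Y (f : hom A X) (g : hom A Y) : π₁ ∘ ⟨f, g⟩ = f.
Proof.
rewrite /pair -lock comp_assoc proj1_tensor -comp_assoc /proj1 -lock /discard_r.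
by rewrite copy_counitr comp_idr.
Qed.

Lemma proj2_pair A X Y (f : hom A X) (g : hom A Y) : π₂ ∘ ⟨f, g⟩ = g.
Proof.
rewrite /pair -lock comp_assoc proj2_tensor -comp_assoc /proj2 -lock.
by rewrite copy_counitl comp_idr.
Qed.

Lemma tensor_pair A X X' Y Y' (u : hom X X') (v : hom Y Y')
    (f : hom A X) (g : hom A Y) :
  (u ⊗m v) ∘ ⟨f, g⟩ = ⟨u ∘ f, v ∘ g⟩.
Proof. by rewrite /pair -!lock comp_assoc -tensor_comp. Qed.

Lemma pair_det A B X Y (f : hom B X) (g : hom B Y) (d : hom A B) :
  deterministic d -> ⟨f, g⟩ ∘ d = ⟨f ∘ d, g ∘ d⟩.
Proof. by move=> dd; rewrite -tensor_pair -dd /pair -lock comp_assoc. Qed.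

Lemma copyE X : copy X = ⟨id X, id X⟩.
Proof. by rewrite /pair -!lock tensor_id comp_idl. Qed.

Lemma swap_pair A X Y (f : hom A X) (g : hom A Y) : swap X Y ∘ ⟨f, g⟩ = ⟨g, f⟩.
Proof. by rewrite /pair -!lock comp_assoc swap_natural -comp_assoc copy_cocomm. Qed.

Lemma assoc_pair A X Y Z (f : hom A X) (g : hom A Y) (h : hom A Z) :
  assoc X Y Z ∘ ⟨⟨f, g⟩, h⟩ = ⟨f, ⟨g, h⟩⟩.
Proof.
rewrite /pair -!lock tensor_compl tensor_compr; rewA (assoc_natural _ _ _).
by rewrite -copy_coassoc -!comp_assoc.
Qed.

Lemma assoc_inv_pair A X Y Z (f : hom A X) (g : hom A Y) (h : hom A Z) :
  assoc_inv X Y Z ∘ ⟨f, ⟨g, h⟩⟩ = ⟨⟨f, g⟩, h⟩.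
Proof. by rewrite -assoc_pair comp_assoc assocK comp_idl. Qed.

Lemma mid_swap_pair A X Y Z T (f : hom A X) (g : hom A Y) (h : hom A Z)
    (k : hom A T) :
  mid_swap X Y Z T ∘ ⟨⟨f, g⟩, ⟨h, k⟩⟩ = ⟨⟨f, h⟩, ⟨g, k⟩⟩.
Proof.
rewrite /mid_swap -!comp_assoc assoc_pair !tensor_pair assoc_inv_pair.
by rewrite tensor_pair swap_pair assoc_pair assoc_inv_pair !comp_idl.
Qed.

(** Copying a product copies each factor; the projections then keep one copy of each. *)
Lemma pair_proj X Y : ⟨proj1 X Y, proj2 X Y⟩ = id (X ⊗ Y).
Proof.
rewrite /pair -!lock copy_tensor comp_assoc mid_swap_proj12 -tensor_comp.
by rewrite !copyE proj1_pair proj2_pair tensor_id.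
Qed.

Lemma deterministic_proj1 X Y : deterministic (proj1 X Y).
Proof.
by rewrite /deterministic /pair -lock -(proj1_tensor _ (copy Y)) -mid_swap_proj11
   -comp_assoc -copy_tensor.
Qed.

Lemma deterministic_proj2 X Y : deterministic (proj2 X Y).
Proof.
by rewrite /deterministic /pair -lock -(proj2_tensor (copy X)) -mid_swap_proj22
   -comp_assoc -copy_tensor.
Qed.

Lemma deterministic_id X : deterministic (id X).
Proof. by rewrite /deterministic comp_idr copyE. Qed.

Lemma deterministic_comp X Y Z (e : hom Y Z) (d : hom X Y) :
  deterministic e -> deterministic d -> deterministic (e ∘ d).
Proof.
by move=> de dd; rewrite /deterministic comp_assoc de pair_det.
Qed.

Lemma deterministic_pair A X Y (d : hom A X) (e : hom A Y) :
  deterministic d -> deterministic e -> deterministic ⟨d, e⟩.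
Proof.
move=> dd de; rewrite /deterministic copy_tensor -comp_assoc tensor_pair dd de.
exact: mid_swap_pair.
Qed.

End Pairing.

#[local] Hint Resolve deterministic_proj1 deterministic_proj2 deterministic_id
  deterministic_comp deterministic_pair : det.

(** * Structural morphisms as tuples of projections *)

Section Structural.

Context {C : markovCategory}.
Implicit Types A X Y Z : C.

(** A general [d] may correlate its two outputs, and the tuple of its marginals forgets this;
    determinism rules it out. *)
Lemma pair_eta A X Y (d : hom A (X ⊗ Y)) :
  deterministic d -> ⟨π₁ ∘ d, π₂ ∘ d⟩ = d.
Proof. by move=> dd; rewrite -pair_det // pair_proj comp_idl. Qed.

Lemma tensorE X X' Y Y' (f : hom X X') (g : hom Y Y') :
  f ⊗m g = ⟨f ∘ π₁, g ∘ π₂⟩.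
Proof. by rewrite -tensor_pair pair_proj comp_idr. Qed.

Lemma swapE X Y : swap X Y = ⟨π₂, π₁⟩.
Proof. by rewrite -swap_pair pair_proj comp_idr. Qed.

Lemma assocE X Y Z : assoc X Y Z = ⟨π₁ ∘ π₁, ⟨π₂ ∘ π₁, π₂⟩⟩.
Proof. by rewrite -assoc_pair pair_eta ?pair_proj ?comp_idr; auto with det. Qed.

Lemma assoc_invE X Y Z : assoc_inv X Y Z = ⟨⟨π₁, π₁ ∘ π₂⟩, π₂ ∘ π₂⟩.
Proof.
by rewrite -assoc_inv_pair pair_eta ?pair_proj ?comp_idr; auto with det.
Qed.

End Structural.

Ltac push_det :=
  match goal with
  | |- context [⟨?u, ?v⟩ ∘ (?d ∘ ?k)] =>
      rewrite (comp_reassoc (@pair_det _ _ _ _ _ u v d _)); [solve [auto 20 with det] |]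
  | |- context [⟨?u, ?v⟩ ∘ ?d] =>
      rewrite (@pair_det _ _ _ _ _ u v d); [solve [auto 20 with det] |]
  end.

Ltac fold_eta :=
  match goal with
  | |- context [⟨π₁ ∘ ?d, π₂ ∘ ?d⟩] =>
      rewrite (@pair_eta _ _ _ _ d); [solve [auto 20 with det] |]
  end.

Ltac beta_proj :=
  repeat progress rewrite -?comp_assoc ?comp_idl ?comp_idr ?proj1_pair ?proj2_pair
    ?(comp_reassoc (proj1_pair _ _)) ?(comp_reassoc (proj2_pair _ _)) ?pair_proj
    ?tensor_pair ?swap_pair ?assoc_pair ?assoc_inv_pair.

Ltac beta := beta_proj; repeat (first [push_det | fold_eta]; beta_proj).

(* The symmetries are expanded last, so that they can first be applied to tuples
   with nondeterministic components. *)
Ltac structural :=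
  beta; rewrite ?tensorE ?assocE ?assoc_invE ?copyE; beta; rewrite ?swapE; beta.

(** * Order of sampling and the tuple form of conditional independence *)

Section Sampling.

Context {C : markovCategory}.
Implicit Types A B X Y Z T W : C.

(* [a ∘ ⟨t, id⟩] first samples [t] and then runs [a] on the sample together with
   the input, so the next four lemmas move a sampling to the front of a tuple. *)
Lemma pair_bindl A T X Y (t : hom A T) (a : hom (T ⊗ A) X) (b : hom A Y) :
  ⟨a ∘ ⟨t, id A⟩, b⟩ = ⟨a, b ∘ π₂⟩ ∘ ⟨t, id A⟩.
Proof.
(* Both sides run [t] once, so coassociativity of copying suffices for an arbitrary [t]. *)
have E : ⟨⟨t, id A⟩, id A⟩ = ⟨id _, π₂⟩ ∘ ⟨t, id A⟩.
  have -> : ⟨id (T ⊗ A), π₂⟩ = assoc_inv T A A ∘ (id T ⊗m copy A).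
    by structural.
  by rewrite -comp_assoc tensor_pair comp_idl comp_idr copyE assoc_inv_pair.
rewrite -{1}(comp_idr b) -tensor_pair E comp_assoc tensor_pair.
by rewrite comp_idr.
Qed.

Lemma pair_bindr A T X Y (t : hom A T) (a : hom (T ⊗ A) X) (b : hom A Y) :
  ⟨b, a ∘ ⟨t, id A⟩⟩ = ⟨b ∘ π₂, a⟩ ∘ ⟨t, id A⟩.
Proof. by rewrite -swap_pair pair_bindl comp_assoc swap_pair. Qed.

Lemma pair_samplel A X Y (t : hom A X) (b : hom A Y) :
  ⟨t, b⟩ = ⟨π₁, b ∘ π₂⟩ ∘ ⟨t, id A⟩.
Proof. by rewrite -pair_bindl proj1_pair. Qed.

Lemma pair_sampler A X Y (t : hom A X) (b : hom A Y) :
  ⟨b, t⟩ = ⟨b ∘ π₂, π₁⟩ ∘ ⟨t, id A⟩.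
Proof. by rewrite -pair_bindr proj1_pair. Qed.

(** Here [h] takes [W ⊗ A] rather than [A ⊗ W], so that both channels act on the same sampled pair;
    [swap] translates between the two forms. *)
Lemma displays_ciE A X W Y (f : hom A (X ⊗ W ⊗ Y)) :
  displays_ci X W Y f <->
  exists (g : hom A W) (h : hom (W ⊗ A) X) (k : hom (W ⊗ A) Y),
    f = ⟨⟨h, π₁⟩, k⟩ ∘ ⟨g, id A⟩.
Proof.
have E (g : hom A W) h k :
    (h ⊗m id W ⊗m k) ∘ ci_regroup A W ∘ (id A ⊗m copy3 W ⊗m id A)
        ∘ (id A ⊗m g ⊗m id A) ∘ copy3 A
    = ⟨⟨h ∘ swap W A, π₁⟩, k⟩ ∘ ⟨g, id A⟩ :> hom A (X ⊗ W ⊗ Y).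
  have -> : (h ⊗m id W ⊗m k) ∘ ci_regroup A W ∘ (id A ⊗m copy3 W ⊗m id A)
      = ⟨⟨h ∘ π₁, π₂ ∘ π₁⟩, k ∘ ⟨π₂ ∘ π₁, π₂⟩⟩.
    by rewrite /ci_regroup /copy3; structural.
  have -> : copy3 A = ⟨⟨id A, id A⟩, id A⟩.
    by rewrite /copy3 !copyE tensor_pair !comp_idr.
  rewrite -comp_assoc !tensor_pair !comp_idl comp_idr.
  (* The sample from [g] is drawn first; the outer copies of the input are then read off the input
     kept beside it. *)
  rewrite (pair_sampler g (id A)) pair_bindl.
  by rewrite comp_assoc; congr (_ ∘ _); structural.
split=> [[g [h [k ->]]]|[g [h [k ->]]]].
  by exists g, (h ∘ swap W A), k; rewrite E.
by exists g, (h ∘ swap A W), k; rewrite E -comp_assoc swapK comp_idr.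
Qed.

End Sampling.

(** * The four properties of conditional independence *)

Section ConditionalIndependence.

Context {C : markovCategory}.
Implicit Types A X Y Z W : C.

(** In tuple form the permutation just exchanges [h] and [k]. *)
Lemma displays_ci_symmetry A X W Y (f : hom A (X ⊗ W ⊗ Y)) :
  displays_ci X W Y f -> displays_ci Y W X (outer_swap X W Y ∘ f).
Proof.
move=> /displays_ciE [g [h [k ->]]]; apply/displays_ciE; exists g, k, h.
rewrite comp_assoc /outer_swap -!comp_assoc (comp_reassoc (swap_pair _ _)).
rewrite (comp_reassoc (tensor_pair _ _ _ _)) comp_idl swap_pair.
by rewrite (comp_reassoc (assoc_inv_pair _ _ _)).
Qed.

Lemma displays_ci_decomposition A X1 X2 W Y (f : hom A (X1 ⊗ X2 ⊗ W ⊗ Y)) :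
  displays_ci (X1 ⊗ X2) W Y f ->
  displays_ci X1 W Y ((discard_r X1 X2 ⊗m id W ⊗m id Y) ∘ f).
Proof.
move=> /displays_ciE [g [h [k ->]]]; apply/displays_ciE.
exists g, (discard_r X1 X2 ∘ h), k.
by rewrite comp_assoc !tensor_pair !comp_idl.
Qed.

Lemma displays_ci_contraction A X W Z Y (f : hom A (X ⊗ W ⊗ Z ⊗ Y)) :
  displays_ci X (W ⊗ Z) Y ((assoc X W Z ⊗m id Y) ∘ f) ->
  displays_ci X W Z (discard_r (X ⊗ W ⊗ Z) Y ∘ f) ->
  displays_ci X W (Z ⊗ Y) (assoc (X ⊗ W) Z Y ∘ f).
Proof.
move=> /displays_ciE [g [h [k Ef]]] /displays_ciE [g' [h' [k' Em]]].
have {}Em : π₁ ∘ f = ⟨⟨h', π₁⟩, k'⟩ ∘ ⟨g', id A⟩ by rewrite /proj1 -lock.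
have Ff : f = (assoc_inv X W Z ⊗m id Y) ∘ (⟨⟨h, π₁⟩, k⟩ ∘ ⟨g, id A⟩).
  by rewrite -Ef comp_assoc -tensor_comp assocK comp_idl tensor_id comp_idl.
(* The marginal on [X ⊗ (W ⊗ Z)], computed from each hypothesis. *)
have Eu : ⟨h, π₁⟩ ∘ ⟨g, id A⟩ = ⟨h', ⟨π₁, k'⟩⟩ ∘ ⟨g', id A⟩.
  rewrite -(proj1_pair ⟨h, π₁⟩ k) -comp_assoc -Ef comp_assoc proj1_tensor.
  by rewrite -comp_assoc Em comp_assoc assoc_pair.
(* Draw the triple from its marginal, then [y] from the input and the pair [(w, z)], which [π₂ ∘ π₁]
   reads off the triple. *)
have Ew : ⟨⟨h, π₁⟩, k⟩ ∘ ⟨g, id A⟩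
    = ⟨π₁, k ∘ ⟨π₂ ∘ π₁, π₂⟩⟩ ∘ ⟨⟨h, π₁⟩ ∘ ⟨g, id A⟩, id A⟩.
  rewrite pair_bindl comp_assoc; congr (_ ∘ _).
  rewrite (pair_samplel h) !pair_bindl comp_assoc; congr (_ ∘ _).
  by structural.
apply/displays_ciE.
(* The last channel draws [z] from [k'] and then [y] from [k] at [(w, z)] and the input. *)
exists g', h', (⟨π₁, k ∘ ⟨⟨π₁ ∘ π₂, π₁⟩, π₂ ∘ π₂⟩⟩ ∘ ⟨k', id _⟩).
rewrite Ff Ew Eu pair_bindl !comp_assoc; congr (_ ∘ _).
(* Both sides are brought to the same order, [z] from [k'] and then [x] from [h'], so that the
   samplings cancel one by one. *)
rewrite pair_bindr (pair_sampler k') pair_bindr pair_bindl.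
rewrite !comp_assoc; congr (_ ∘ _).
rewrite (@pair_det _ _ _ _ _ h' π₁ π₂); first by auto with det.
rewrite (pair_samplel _ ⟨_, π₁⟩) (pair_samplel _ (π₁ ∘ π₂)) !pair_bindl !comp_assoc; congr (_ ∘ _).
by structural.
Qed.

Lemma displays_ci_weak_union A X1 X2 W Y (f : hom A (X1 ⊗ X2 ⊗ W ⊗ Y)) :
  has_conditionals C ->
  displays_ci (X1 ⊗ X2) W Y f ->
  displays_ci X1 (W ⊗ X2) Y
    ((((id X1 ⊗m swap X2 W) ∘ assoc X1 X2 W) ⊗m id Y) ∘ f).
Proof.
move=> cond /displays_ciE [g [h [k ->]]]; apply/displays_ciE.
(* The swap puts [X2] first, so that [c] draws [x1] given [x2], [w] and the input. *)
have [c Ec] := cond _ _ _ (swap X1 X2 ∘ h).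
set t := discard_r X2 X1 ∘ (swap X1 X2 ∘ h) in Ec.
have Eh : h = ⟨c, π₁⟩ ∘ ⟨t, id (W ⊗ A)⟩.
  have {}Ec : swap X1 X2 ∘ h
      = (id X2 ⊗m c) ∘ assoc _ _ _ ∘ (copy X2 ⊗m id _) ∘ ⟨t, id (W ⊗ A)⟩.
    by rewrite Ec /pair -lock !comp_assoc.
  rewrite -(comp_idl h) -(swapK X1 X2) -comp_assoc Ec !comp_assoc.
  congr (_ ∘ _).
  by structural.
(* Draw [w] from [g], then [x2] from its marginal [t], and output [(w, x2)]. The channel for [x1] is
   [c] with its inputs regrouped; the one for [y] ignores [x2]. *)
exists (⟨π₁ ∘ π₂, π₁⟩ ∘ ⟨t, id _⟩ ∘ ⟨g, id A⟩).
exists (c ∘ ⟨π₂ ∘ π₁, ⟨π₁ ∘ π₁, π₂⟩⟩), (k ∘ ⟨π₁ ∘ π₁, π₂⟩).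
rewrite (pair_bindl g) !comp_assoc; congr (_ ∘ _).
rewrite {1}Eh !pair_bindl !comp_assoc; congr (_ ∘ _).
by structural.
Qed.

End ConditionalIndependence.

Theorem proposition12p17 (C : markovCategory) :
  (* (a) symmetry *)
  (forall (A X W Y : C) (f : hom A (X ⊗ W ⊗ Y)),
      displays_ci X W Y f ->
      displays_ci Y W X (outer_swap X W Y ∘ f))
  /\
  (* (b) decomposition *)
  (forall (A X1 X2 W Y : C) (f : hom A (X1 ⊗ X2 ⊗ W ⊗ Y)),
      displays_ci (X1 ⊗ X2) W Y f ->
      displays_ci X1 W Y ((discard_r X1 X2 ⊗m id W ⊗m id Y) ∘ f))
  /\
  (* (c) contraction *)
  (forall (A X W Z Y : C) (f : hom A (X ⊗ W ⊗ Z ⊗ Y)),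
      displays_ci X (W ⊗ Z) Y ((assoc X W Z ⊗m id Y) ∘ f) ->
      displays_ci X W Z (discard_r (X ⊗ W ⊗ Z) Y ∘ f) ->
      displays_ci X W (Z ⊗ Y) (assoc (X ⊗ W) Z Y ∘ f))
  /\
  (* (d) weak union *)
  (has_conditionals C ->
   forall (A X1 X2 W Y : C) (f : hom A (X1 ⊗ X2 ⊗ W ⊗ Y)),
      displays_ci (X1 ⊗ X2) W Y f ->
      displays_ci X1 (W ⊗ X2) Y
        ((((id X1 ⊗m swap X2 W) ∘ assoc X1 X2 W) ⊗m id Y) ∘ f)).
Proof.
split; first exact: displays_ci_symmetry.
split; first exact: displays_ci_decomposition.
split; first exact: displays_ci_contraction.
by move=> cond A X1 X2 W Y f; exact: displays_ci_weak_union.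
Qed.
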